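(* If a finite set $\mathcal C$ of propositional clauses has the termination property, then $\mathcal C$ is renamable-Horn.
   Context: A propositional literal is a Boolean variable $p$ (positive) or its negation $\neg p$ (negative). A clause is a disjunction of literals, regarded as a multiset of literals. A Horn clause is a clause with at most one positive literal. A set $\mathcal C$ of clauses has the termination property if there is no infinite sequence $c_0,c_1,c_2,\dots$ of clauses with $c_0\in\mathcal C$ and, for each $i\ge1$, $c_i$ derived by binary resolution from $c_{i-1}$ and a clause of $\mathcal C$, using the rule: from $C\vee p$ and $D\vee\neg p$ derive $C\vee D$. For a set $A$ of Boolean variables, $r_A(\mathcal C)$ is the result of replacing in $\mathcal C$ every literal whose variable is in $A$ by its complement; $\mathcal C$ is renamable-Horn if there is some set $A$ of Boolean variables such that every clause of $r_A(\mathcal C)$ is Horn. *)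

(* Defs.v *)
From HB Require Import structures.
From mathcomp Require Import all_boot finmap multiset.

Set Implicit Arguments.
Unset Strict Implicit.
Unset Printing Implicit Defensive.

Local Open Scope fset_scope.
Local Open Scope mset_scope.

Section Clauses.

Variable V : choiceType.

(* [(p, true)] is the literal p, [(p, false)] is its negation. *)
Definition literal : choiceType := (V * bool)%type.

Definition pos (p : V) : literal := (p, true).
Definition neg (p : V) : literal := (p, false).

Definition var (l : literal) : V := l.1.
Definition positive (l : literal) : bool := l.2.
Definition complement (l : literal) : literal := (l.1, ~~ l.2).

Definition clause : choiceType := {mset literal}.

(* Occurrences are counted with multiplicity: p \/ p is not Horn. *)
Definition horn (c : clause) : bool := count positive (enum_mset c) <= 1.

(* The order of the premises matters: the first one contains the positive
   occurrence of the variable that is resolved upon. *)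
Definition resolution (c1 c2 c : clause) : Prop :=
  exists (p : V) (C D : clause),
    [/\ c1 = C `+` [mset pos p], c2 = D `+` [mset neg p] & c = C `+` D].

Definition derived_from (c d e : clause) : Prop :=
  resolution c d e \/ resolution d c e.

Definition termination_property (CC : {fset clause}) : Prop :=
  ~ exists c : nat -> clause,
      c 0 \in CC /\
      forall i, exists2 d : clause, d \in CC & derived_from (c i) d (c i.+1).

Definition rename_literal (A : {pred V}) (l : literal) : literal :=
  if var l \in A then complement l else l.

Definition rename_clause (A : {pred V}) (c : clause) : clause :=
  seq_mset [seq rename_literal A l | l <- enum_mset c].

Definition rename (A : {pred V}) (CC : {fset clause}) : {fset clause} :=
  [fset rename_clause A c | c in CC].

Definition renamable_horn (CC : {fset clause}) : Prop :=
  exists A : {pred V}, forall c : clause, c \in rename A CC -> horn c.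

End Clauses.

(* Main.v *)
Require Import Defs.
From mathcomp Require Import all_boot finmap multiset.

(** Renaming to Horn clauses is a 2-SAT problem: no two literal occurrences of
    a clause may both become positive.  In its implication graph, an edge
    [L -> M] comes from a clause containing [L] and the complement of [M].
    Following an infinite path of this graph and resolving successively with
    the clauses of its edges is an infinite derivation, so the termination
    property makes this finite graph acyclic, and it carries a rank that
    decreases along edges.  The graph is invariant under
    [L -> M |-> ~M -> ~L], so making a literal positive when its rank is at
    most that of its complement solves the 2-SAT problem. *)

Set Implicit Arguments.
Unset Strict Implicit.
Unset Printing Implicit Defensive.

Local Open Scope fset_scope.
Local Open Scope mset_scope.

(** The rank of a vertex is the number of vertices reachable from it. Along an edge from [x] to [y]
    the reachable set shrinks and loses [x]: a path from [y] back to [x] would close a cycle, and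
    running around it forever is an infinite path. *)
Lemma rank_of_acyclic_rel (T : finType) (e : rel T) :
    (forall f : nat -> T, ~ forall i, e (f i) (f i.+1)) ->
  forall x y, e x y -> #|connect e y| < #|connect e x|.
Proof.
move=> no_path x y exy; apply/proper_card/properP; split.
  by apply/subsetP=> z; apply/connect_trans/connect1.
exists x; first exact: connect0.
apply/negP=> /connectP [p yp x_last].
have cyc : cycle e (y :: p) by rewrite /= rcons_path yp -x_last.
pose f i := iter i (next (y :: p)) y.
have fp i : f i \in y :: p.
  elim: i => [|i IHi]; first exact: mem_head.
  by rewrite [f _]iterS mem_next.
by apply: (no_path f) => i; apply: (next_cycle cyc (fp i)).
Qed.

Lemma rank_of_finite_acyclic_rel (T : choiceType) (e : rel T) (S : seq T) :
    (forall x y, e x y -> (x \in S) && (y \in S)) ->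
    (forall f : nat -> T, ~ forall i, e (f i) (f i.+1)) ->
  exists r : T -> nat, forall x y, e x y -> r y < r x.
Proof.
move=> eS no_path; pose e' := relpre (val : seq_sub S -> T) e.
(* Edges stay inside [S], so the default 0 is never compared. *)
exists (fun x => if insub x is Some u then #|connect e' u| else 0) => x y exy.
have /andP[xS yS] := eS _ _ exy.
rewrite !insubT; apply: rank_of_acyclic_rel => // f path_f.
exact: (no_path (val \o f)).
Qed.

Lemma count_gt1 (T : eqType) (a : pred T) (s : seq T) :
  1 < count a s -> exists x y, [/\ a x, a y, x \in s & y \in rem x s].
Proof.
move=> a_gt1; have /hasP[x xs ax] : has a s by rewrite has_count ltnW.
have := permP (perm_to_rem xs) a; rewrite /= ax add1n => a_rem.
have /hasP[y ys ay] : has a (rem x s) by rewrite has_count -ltnS -a_rem.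
by exists x, y.
Qed.

Section ImplicationGraph.

Variable V : choiceType.
Implicit Types (c d : {mset literal V}) (L M : literal V).
Implicit Type CC : {fset clause V}.

Lemma complementK : involutive (@complement V).
Proof. by case=> p b; rewrite /complement /= negbK. Qed.

(** Only one occurrence of [L] is removed, so a repeated [L] gives an edge from [L] to its
    complement. *)
Definition clause_edge c L M : bool :=
  (L \in c) && (complement M \in c `\ L).

Definition implication CC L M : bool := has (fun c => clause_edge c L M) CC.

Lemma implicationC CC L M :
  implication CC L M = implication CC (complement M) (complement L).
Proof.
apply: eq_has => c; rewrite /clause_edge complementK !in_msetB1 eq_sym.
by have [->|_] := eqVneq L (complement M); rewrite // andbC.
Qed.

Definition literals_of CC : seq (literal V) :=
  flatten [seq enum_mset c | c : clause V <- CC].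

Lemma implication_literals CC L M : implication CC L M ->
  (L \in literals_of CC) && (complement M \in literals_of CC).
Proof.
case/hasP=> c cC /andP[Lc]; rewrite in_msetB1 => /andP[_ Mc].
by apply/andP; split; apply/flatten_mapP; exists c.
Qed.

Lemma derived_from_complement c d L :
    complement L \in c -> L \in d ->
  derived_from c d ((c `\ complement L) `+` (d `\ L)).
Proof.
(* The sign of [L] decides which premise carries the positive occurrence. *)
case: L => p [] Lc Ld; [right | left].
  exists p, (d `\ pos p), (c `\ neg p).
  by split; rewrite 1?msetDC ?msetB1K.
exists p, (c `\ pos p), (d `\ neg p).
by split; rewrite 1?msetDC ?msetB1K // msetDC.
Qed.

Lemma implication_no_path CC (f : nat -> literal V) :
  termination_property CC -> ~ forall i, implication CC (f i) (f i.+1).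
Proof.
move=> termC path_f; apply: termC.
pose d i : {mset literal V} :=
  nth (mset0 : clause V) CC (find (fun c => clause_edge c (f i) (f i.+1)) CC).
have dC i : d i \in CC by rewrite mem_nth // -has_find; apply: path_f.
have /all_and2[fd f1d] i : f i \in d i /\ complement (f i.+1) \in d i `\ f i.
  exact/andP/(nth_find _ (path_f i)).
(* [c i] keeps the complement of [f i.+1], inherited from [d i], and is resolved on it with
   [d i.+1]. *)
pose c := nat_rect (fun=> {mset literal V}) (d 0)
  (fun i ci => (ci `\ complement (f i.+1)) `+` (d i.+1 `\ f i.+1)).
have fc i : complement (f i.+1) \in c i.
  case: i => [|i] /=; last by rewrite in_msetD f1d orbT.
  by have := f1d 0; rewrite in_msetB1 => /andP[].
exists c; split=> [|i]; first exact: dC.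
by exists (d i.+1); rewrite ?dC //; apply: derived_from_complement.
Qed.

Lemma rank_literal CC : termination_property CC ->
  exists r : literal V -> nat, forall L M, implication CC L M -> r M < r L.
Proof.
move=> termC; pose S := literals_of CC.
(* The target of an edge may occur in the clauses only as its complement. *)
apply: (@rank_of_finite_acyclic_rel _ _ (S ++ map (@complement V) S)).
  move=> L M /implication_literals /andP[LS MS]; rewrite !mem_cat LS /=.
  by rewrite -[M]complementK (map_f _ MS) orbT.
by move=> f; apply: implication_no_path.
Qed.

Lemma horn_rename_clause (A : {pred V}) c :
    (forall L M, clause_edge c L (complement M) ->
      ~~ (positive (rename_literal A L) && positive (rename_literal A M))) ->
  horn (rename_clause A c).
Proof.
move=> edgeN; rewrite /horn (permP (perm_eq_seq_mset _)) count_map leqNgt.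
apply/negP=> /count_gt1 [L [M [/= posL posM Lc Mc]]].
suff /edgeN : clause_edge c L (complement M) by rewrite posL posM.
rewrite /clause_edge Lc complementK in_msetB -(count_mem_mset M c) /=.
rewrite (permP (perm_to_rem Lc)) /= msetnE (eq_sym L).
have : 0 < count_mem M (rem L (enum_mset c)) by rewrite -has_count has_pred1.
by case: eqP.
Qed.

Definition rank_renaming (r : literal V -> nat) : {pred V} :=
  [pred p | r (neg p) < r (pos p)].

Lemma positive_rename_rank (r : literal V -> nat) L :
    positive (rename_literal (rank_renaming r) L) ->
  r L <= r (complement L).
Proof.
case: L => p []; rewrite /rename_literal /positive /= inE; case: ltnP => //.
by move=> /ltnW.
Qed.

End ImplicationGraph.

Theorem theorem2 (V : choiceType) (CC : {fset (clause V)}) :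
  termination_property CC -> renamable_horn CC.
Proof.
move=> /rank_literal [r r_lt].
exists (rank_renaming r) => _ /imfsetP [c /= cC ->].
apply: horn_rename_clause => L M edgeLM; apply/negP.
case/andP=> /positive_rename_rank rL /positive_rename_rank rM.
(* With [~] for [complement], the edge and its contrapositive give the contradiction
   [r L <= r ~L < r M <= r ~M < r L]. *)
have impLM : implication CC L (complement M) by apply/hasP; exists c.
have := r_lt _ _ impLM; rewrite implicationC complementK in impLM.
move=> /(leq_ltn_trans rM) /leq_trans /(_ rL).
by move=> /ltn_trans /(_ (r_lt _ _ impLM)); rewrite ltnn.
Qed.
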